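(* Let $E$ be a weakly order-Rickart JB$^*$-triple. Then for each tripotent $e\in E$, the Peirce-2 subspace $E_2(e)$ is a Rickart JB$^*$-algebra.
   Context: In a JB$^*$-triple $E$ write $L(a,b)z=\{a,b,z\}$ and $Q(a)z=\{a,z,a\}$. An inner ideal of $E$ is a linear subspace $I$ with $\{I,E,I\}\subseteq I$; for $x\in E$, $E(x)$ is the norm closure of $Q(x)(E)$, the norm-closed inner ideal generated by $x$. Elements $a,b$ are orthogonal ($a\perp b$) if $L(a,b)=0$; for subsets $I\perp J$ means $a\perp b$ for all $a\in I,b\in J$. A tripotent is $e\in E$ with $\{e,e,e\}=e$, and $E_i(e)$ is the $\frac i2$-eigenspace of $L(e,e)$, $i=0,1,2$. $E_2(e)$ is a JB$^*$-algebra with unit $e$, product $x\circ_e y=\{x,e,y\}$ and involution $x^{*_e}=\{e,x,e\}$. $E$ is a weakly order-Rickart JB$^*$-triple if given $x\in E$ and an inner ideal $J\subseteq E$ with $E(x)\perp J$, there exists a tripotent $e\in E$ such that $x$ is a positive element of the JB$^*$-algebra $E_2(e)$ and $J\subseteq E_0(e)$. In a Jordan algebra, $U_a(x)=2(a\circ x)\circ a-a^2\circ x$. A JB$^*$-algebra $M$ is a Rickart JB$^*$-algebra if its self-adjoint part $N=M_{sa}$ is a Rickart Jordan algebra, i.e. for each $a\in N^2=\{b^2:b\in N\}$ there is an idempotent $p\in N$ with $\{z\in N:U_z(a)=0\}=U_p(N)$. *)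

(* Defs.v *)
From HB Require Import structures.
From mathcomp Require Import all_boot all_order all_algebra.
From mathcomp Require Import complex.
From mathcomp Require Import all_classical all_reals all_analysis.

Set Implicit Arguments.
Unset Strict Implicit.
Unset Printing Implicit Defensive.

Import Order.TTheory GRing.Theory Num.Theory.
Import numFieldNormedType.Exports.

Local Open Scope classical_set_scope.
Local Open Scope ring_scope.
Local Open Scope complex_scope.

Section Operators.
Variables (R : realType) (E : completeNormedModType R[i]).
Implicit Type T : E -> E.

(* exp (i t T) z; the limit exists when T is a bounded linear operator. *)
Definition exp_itT T (t : R) (z : E) : E :=
  limn (series (fun n : nat => ((t *i) ^+ n / n`!%:R) *: iter n T z)).

(* T is hermitian: every exp (i t T), t real, is an isometry. *)
Definition hermitian_op T : Prop :=
  forall (t : R) (z : E), `|exp_itT T t z| = `|z|.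

Definition op_spectrum T : set R[i] :=
  [set l | ~ exists S : {linear E -> E},
     [/\ continuous S,
         forall z, S (T z - l *: z) = z
       & forall z, T (S z) - l *: S z = z]].

End Operators.

Section JBstarTriple.
Variables (R : realType) (E : completeNormedModType R[i]).
(* tp a b c is the triple product {a, b, c} *)
Variable tp : E -> E -> E -> E.

Definition Lop (a b z : E) : E := tp a b z.
Definition Qop (a z : E) : E := tp a z a.

(* In the order of R[i], 0 <= l means that l is real and nonnegative. *)
Record is_JBstar_triple : Prop := IsJBstarTriple {
  jbt_sym : forall a b c, tp a b c = tp c b a;
  jbt_linear : forall (k : R[i]) a a' b c,
    tp (k *: a + a') b c = k *: tp a b c + tp a' b c;
  jbt_antilinear : forall (k : R[i]) a b b' c,
    tp a (k *: b + b') c = k^* *: tp a b c + tp a b' c;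
  jbt_continuous : continuous (fun u : E * E * E => tp u.1.1 u.1.2 u.2);
  jbt_jordan : forall a b x y z,
    Lop a b (tp x y z) =
      tp (Lop a b x) y z - tp x (Lop b a y) z + tp x y (Lop a b z);
  jbt_hermitian : forall a, hermitian_op (Lop a a);
  jbt_spectrum : forall (a : E) (l : R[i]), op_spectrum (Lop a a) l -> 0 <= l;
  jbt_norm : forall a, `|tp a a a| = `|a| ^+ 3 }.

Definition inner_ideal (J : set E) : Prop :=
  [/\ J 0,
      forall (k : R[i]) a b, J a -> J b -> J (k *: a + b)
    & forall a z b, J a -> J b -> J (tp a z b)].

Definition principal_inner_ideal (x : E) : set E := closure (range (Qop x)).

Definition orthogonal (a b : E) : Prop := forall z, Lop a b z = 0.

Definition orthogonal_sets (I J : set E) : Prop :=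
  forall a b, I a -> J b -> orthogonal a b.

Definition tripotent (e : E) : Prop := tp e e e = e.

Definition peirce (i : nat) (e : E) : set E :=
  [set z | Lop e e z = (i%:R / 2) *: z].

Definition peirce2_mul (e x y : E) : E := tp x e y.
Definition peirce2_star (e x : E) : E := tp e x e.

End JBstarTriple.

(* Jordan algebras are given by a carrier M inside an ambient complex vector
   space and by a product (and an involution) of which only the restriction
   to M matters. *)
Section JordanAlgebras.
Variables (R : realType) (E : lmodType R[i]).
Implicit Types (M N : set E) (mul : E -> E -> E) (star : E -> E).

Definition selfadjoint_part M star : set E := [set x | M x /\ star x = x].

Definition squares N mul : set E := [set mul b b | b in N].

(* The positive cone of a JB*-algebra consists of the squares of its
   self-adjoint elements. *)
Definition positive_elements M mul star : set E :=
  squares (selfadjoint_part M star) mul.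

Definition Uop mul (a x : E) : E :=
  mul (mul a x) a *+ 2 - mul (mul a a) x.

Record real_jordan_algebra N mul : Prop := RealJordanAlgebra {
  rja_zero : N 0;
  rja_lin : forall (r : R) x y, N x -> N y -> N (r%:C *: x + y);
  rja_mul : forall x y, N x -> N y -> N (mul x y);
  rja_mulC : forall x y, N x -> N y -> mul x y = mul y x;
  rja_mul_lin : forall (r : R) x y z, N x -> N y -> N z ->
    mul (r%:C *: x + y) z = r%:C *: mul x z + mul y z;
  rja_jordan : forall x y, N x -> N y ->
    mul (mul x y) (mul x x) = mul x (mul y (mul x x)) }.

Definition rickart_jordan_algebra N mul : Prop :=
  real_jordan_algebra N mul /\
  forall a, squares N mul a ->
    exists p, [/\ N p, mul p p = p
      & [set z | N z /\ Uop mul z a = 0] = Uop mul p @` N].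

(* A JB*-algebra M, with product mul and involution star, is Rickart when its
   self-adjoint part is a Rickart Jordan algebra. *)
Definition rickart_JBstar_algebra M mul star : Prop :=
  rickart_jordan_algebra (selfadjoint_part M star) mul.

End JordanAlgebras.

Definition weakly_order_rickart (R : realType) (E : completeNormedModType R[i])
    (tp : E -> E -> E -> E) : Prop :=
  forall (x : E) (J : set E), inner_ideal tp J ->
    orthogonal_sets tp (principal_inner_ideal tp x) J ->
    exists e : E, [/\ tripotent tp e,
      positive_elements (peirce tp 2 e) (peirce2_mul tp e)
        (peirce2_star tp e) x
    & J `<=` peirce tp 0 e].

(* Main.v *)
Require Import Defs.
From mathcomp Require Import all_boot all_order all_algebra.
From mathcomp Require Import cyclic separable cyclotomic.
From mathcomp Require Import complex.
From mathcomp Require Import all_classical all_reals all_analysis.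
From mathcomp Require Import ring lra zify.

(** Write x o y = {x,e,y} for the product of E_2(e), and let a = b o b with b
    self-adjoint in E_2(e).  The elements y with {a,y,.} = {y,a,.} = 0 form an
    inner ideal J orthogonal to E(a), so the hypothesis on E provides a
    tripotent f such that a is also a square c^2 of E_2(f) and J lies in
    E_0(f).  The projection sought is p = e - f.

    The heart of the proof is that e - f belongs to J
    ([positive_diff_annihilator]); then e - f lies in E_0(f), that is f <= e,
    and p is a projection of E_2(e) orthogonal to a.  In the bidual this would
    be clear, since e and f both dominate the range tripotent of a.  Here it
    is obtained in two steps.

    - The squares {a,e,a} and {a,f,a} agree ([square_unique]).  The odd powers
      of a are triple powers, the same for e and f, so the difference
      F(z) = (1 - z a)^n a (computed in E_2(e)) - (1 - z a)^n a (in E_2(f))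
      is an odd polynomial in z, with linear coefficient n times the
      difference of the two squares, up to sign.  The identity
      |{u,u,u}| = |u|^3 makes the polynomials in b into a commutative
      C*-seminormed algebra, in which (1 - z b^2)^n stays bounded, uniformly
      in n, on the half circle |z| = n^(-1/2), Re z >= 0, because b^2 is
      positive.  As F is odd it is bounded on the whole circle, and Cauchy's
      estimate for the linear coefficient gives the equality as n grows.

    - Put z = e - f, A = L(a,e) = L(b,b) and B = L(a,f) = L(c,c), two hermitian
      operators, and H = L(a,z) = A - B.  The equality of the squares and the
      Jordan identities give A^2 z = 0, so A z = 0 because A is hermitian;
      this makes A and H commute, while H^3 = 0.  Then
      exp(itA) w = exp(itB)(w + it H w) whenever H^2 w = 0, and as both
      exponentials are isometries H w = 0; applied twice, this gives H = 0.

    It remains to identify {z : U_z(a) = 0} with U_p(N).  If z is self-adjoint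
    and U_z(b^2) = 0, the fundamental formula and the absence of nilpotents
    give first U_b(z^2) = 0, then b o z = 0, and finally that z lies in J
    ([sa_orth]).  Hence z lies in E_0(f), and z = {e,z,e} = {p,z,p}. *)

Set Implicit Arguments.
Unset Strict Implicit.
Unset Printing Implicit Defensive.

Import Order.TTheory GRing.Theory Num.Theory.
Import numFieldNormedType.Exports.

Local Open Scope classical_set_scope.
Local Open Scope ring_scope.
Local Open Scope complex_scope.

(** * Jordan triples and the Peirce-2 algebra of a tripotent *)

Section JordanTriple.
Variables (K : numFieldType) (V : lmodType K).
Variable tp : V -> V -> V -> V.

(** The purely algebraic part of the axioms of a JB*-triple.  Additivity
    suffices for the identities below, which only divide by integers. *)
Record jordan_triple : Prop := JordanTriple {
  jtC : forall a b c, tp a b c = tp c b a;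
  jtDl : forall a a' b c, tp (a + a') b c = tp a b c + tp a' b c;
  jtDm : forall a b b' c, tp a (b + b') c = tp a b c + tp a b' c;
  jtJ : forall a b x y z,
    tp a b (tp x y z) =
      tp (tp a b x) y z - tp x (tp b a y) z + tp x y (tp a b z) }.

Hypothesis Htp : jordan_triple.

Lemma mulrn_eq0_lmod (v : V) n : v *+ n.+1 = 0 -> v = 0.
Proof.
rewrite -scaler_nat => /eqP; rewrite scaler_eq0 pnatr_eq0 /=.
by move/eqP.
Qed.

Lemma mulrn_inj_lmod n (u v : V) : u *+ n.+1 = v *+ n.+1 -> u = v.
Proof.
move=> /eqP; rewrite -subr_eq0 -mulrnBl => /eqP/mulrn_eq0_lmod/eqP.
by rewrite subr_eq0 => /eqP.
Qed.

Lemma tpC a b c : tp a b c = tp c b a.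
Proof. exact: jtC. Qed.

Lemma tpDl a a' b c : tp (a + a') b c = tp a b c + tp a' b c.
Proof. exact: jtDl. Qed.

Lemma tpDm a b b' c : tp a (b + b') c = tp a b c + tp a b' c.
Proof. exact: jtDm. Qed.

Lemma tpDr a b c c' : tp a b (c + c') = tp a b c + tp a b c'.
Proof. by rewrite ![tp a b _]tpC tpDl. Qed.

Lemma tp0l b c : tp 0 b c = 0.
Proof. by apply: (addrI (tp 0 b c)); rewrite -tpDl !addr0. Qed.

Lemma tp0m a c : tp a 0 c = 0.
Proof. by apply: (addrI (tp a 0 c)); rewrite -tpDm !addr0. Qed.

Lemma tp0r a b : tp a b 0 = 0.
Proof. by rewrite tpC tp0l. Qed.

Lemma tpNl a b c : tp (- a) b c = - tp a b c.
Proof. by apply/eqP; rewrite -addr_eq0 -tpDl addNr tp0l. Qed.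

Lemma tpNm a b c : tp a (- b) c = - tp a b c.
Proof. by apply/eqP; rewrite -addr_eq0 -tpDm addNr tp0m. Qed.

Lemma tpNr a b c : tp a b (- c) = - tp a b c.
Proof. by rewrite tpC tpNl tpC. Qed.

Lemma tpBl a a' b c : tp (a - a') b c = tp a b c - tp a' b c.
Proof. by rewrite tpDl tpNl. Qed.

Lemma tpBm a b b' c : tp a (b - b') c = tp a b c - tp a b' c.
Proof. by rewrite tpDm tpNm. Qed.

Lemma tpBr a b c c' : tp a b (c - c') = tp a b c - tp a b c'.
Proof. by rewrite tpDr tpNr. Qed.

Lemma tpMnl n a b c : tp (a *+ n) b c = tp a b c *+ n.
Proof. by elim: n => [|n IH]; rewrite ?mulr0n ?tp0l // !mulrS tpDl IH. Qed.

Lemma tpMnm n a b c : tp a (b *+ n) c = tp a b c *+ n.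
Proof. by elim: n => [|n IH]; rewrite ?mulr0n ?tp0m // !mulrS tpDm IH. Qed.

Lemma tpMnr n a b c : tp a b (c *+ n) = tp a b c *+ n.
Proof. by rewrite tpC tpMnl tpC. Qed.

Lemma tpJ a b x y z :
  tp a b (tp x y z) = tp (tp a b x) y z - tp x (tp b a y) z + tp x y (tp a b z).
Proof. exact: (jtJ Htp). Qed.

(** The Jordan identity as a formula for the commutator [L(x,y), L(u,v)]. *)
Lemma tp_comm x y u v w :
  tp x y (tp u v w) - tp u v (tp x y w) =
  tp (tp x y u) v w - tp u (tp y x v) w.
Proof. by rewrite tpJ addrK. Qed.

(** Take (u,v) = (x,y) in the commutator formula. *)
Lemma tp_JP1 x y w : tp (tp x y x) y w = tp x (tp y x y) w.
Proof.
have := tpJ x y x y w; rewrite -[LHS]add0r => /addIr /esym/eqP.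
by rewrite subr_eq0 => /eqP.
Qed.

(** Let X be the left-hand side, X' the same with y and w exchanged, and Y the
    right-hand side, which is symmetric in y and w.  The Jordan identity gives
    X + Y = 2 X' and X' + Y = 2 X, whence X = Y. *)
Lemma tp_JP2 x y w : tp x y (tp x w x) = tp x (tp y x w) x.
Proof.
have H1 := tpJ x y x w x; have H2 := tpJ x w x y x.
rewrite [tp (tp x w x) y x]tpC [tp w x y]tpC in H2.
rewrite [tp (tp x y x) w x]tpC in H1.
move: H1 H2; set X := tp x y (tp x w x); set Y := tp x (tp y x w) x.
set X' := tp x w (tp x y x) => H1 H2.
have {}H1 : X + Y = X' *+ 2 by rewrite H1 mulr2n addrAC subrK.
have {}H2 : X' + Y = X *+ 2 by rewrite H2 mulr2n addrAC subrK.
apply: (@mulrn_inj_lmod 2); apply: (addrI X).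
have : (X + Y + Y *+ 2) = X *+ 4 by rewrite H1 -mulrnDl H2 -mulrnA.
by rewrite -addrA -!mulrS => ->.
Qed.

(** Expand L(w,y){x,y,x}.  With y a tripotent e this is the formula for the
    U-operator of E_2(e), see [sa_U]. *)
Lemma tp_JP3 x y w :
  tp x y (tp x y w) *+ 2 = tp w y (tp x y x) + tp x (tp y w y) x.
Proof.
rewrite (tpJ w y x y x) ![tp w y x]tpC mulr2n.
by rewrite [tp (tp x y w) _ _]tpC addrAC subrK.
Qed.

(** The fundamental formula Q(Q(x)y) = Q(x)Q(y)Q(x).  Expand L(q,w){x,y,x} for
    q = {x,y,x}; by [tp_JP2] and [tp_JP1] every term is Q(x) of something, and
    the arguments are compared by [tp_JP3]. *)
Lemma tp_fundamental x y w :
  tp (tp x y x) w (tp x y x) = tp x (tp y (tp x w x) y) x.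
Proof.
have H : tp (tp x y x) w x = tp x (tp w x y) x by rewrite tpC tp_JP2.
have H' : tp w (tp x y x) y = tp (tp y x y) x w by rewrite tp_JP1 tpC.
rewrite tpJ H H' [tp (tp x _ x) y x]tpC tp_JP2.
rewrite addrAC -mulr2n -tpMnm -tpBm; congr (tp x _ x).
by rewrite [tp w x y]tpC tp_JP3 [tp w x _]tpC addrAC subrr add0r.
Qed.

(** The self-adjoint elements of E_2(e). *)
Definition sa (e x : V) := tp e e x = x /\ tp e x e = x.

Section Tripotent.
Variable e : V.
Hypothesis He : tp e e e = e.

Lemma sa_e : sa e e.
Proof. by split; exact: He. Qed.

(** Linearization of [tp_JP1] at e in the direction y. *)
Lemma sa_box y w : sa e y -> tp y e w = tp e y w.
Proof.
case=> [y1 y2].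
have H1 := tp_JP1 e (e + y) w; have H2 := tp_JP1 e y w.
rewrite y2 in H2.
move: H1; rewrite !(tpDl, tpDm, tpDr) He y2 [tp y e e]tpC y1 H2.
rewrite -!addrA => /addrI; rewrite !addrA => /addIr.
by move=> /addIr.
Qed.

(** The triple product of a Jordan algebra in terms of its binary product. *)
Lemma sa_triple x w z : sa e w ->
  tp x w z = tp (tp x e w) e z + tp x e (tp w e z) - tp w e (tp x e z).
Proof.
move=> sw; rewrite [tp w e (tp x e z)]tpJ (proj2 sw) [tp w e x]tpC.
by apply/esym/eqP; rewrite subr_eq addrA [_ + (_ - _)]addrC subrK.
Qed.

Lemma sa_mul x y : sa e x -> sa e y -> sa e (tp x e y).
Proof.
move=> sx sy; split.
  by rewrite tpJ He (proj1 sx) (proj1 sy) subrK.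
have Hm : tp e x y = tp x e y by rewrite sa_box.
have Hm' : tp e y x = tp x e y by rewrite -sa_box // tpC.
have := tpJ e x e y e; rewrite (proj2 sx) (proj2 sy) [tp x y e]tpC Hm Hm' => H.
by apply: (addrI (tp x e y)); rewrite {1}H addrAC subrK.
Qed.

Lemma sa_D x y : sa e x -> sa e y -> sa e (x + y).
Proof.
by move=> [x1 x2] [y1 y2]; split; rewrite ?tpDr ?tpDm ?x1 ?x2 ?y1 ?y2.
Qed.

(** L(y,x) = T_(x o y) - [T_x, T_y], where T_x = L(x,e): box operators are
    multiplication operators up to a commutator. *)
Lemma sa_box_comm x y w : sa e x ->
  tp y x w = tp (tp x e y) e w - (tp x e (tp y e w) - tp y e (tp x e w)).
Proof.
by move=> sx; rewrite tp_comm (proj2 sx) opprB addrC subrK.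
Qed.

(** The linearized Jordan identity [T_z, T_(b^2)] = 2 [T_(b o z), T_b]: since
    T_(b^2) = L(b,b), the left side is L(b o z, b) - L(b, b o z). *)
Lemma sa_linJordan b z w : sa e b -> sa e z ->
  tp z e (tp (tp b e b) e w) - tp (tp b e b) e (tp z e w) =
  (tp (tp b e z) e (tp b e w) - tp b e (tp (tp b e z) e w)) *+ 2.
Proof.
move=> sb sz; have sbz := sa_mul sb sz.
have Hb v : tp (tp b e b) e v = tp b b v.
  by rewrite [RHS](sa_box_comm _ _ sb) subrr subr0.
rewrite !Hb tp_comm -(sa_box _ sz) [tp z e b]tpC.
rewrite (sa_box_comm _ _ sb) (sa_box_comm _ _ sbz).
rewrite [tp (tp b e z) e b]tpC.
by rewrite -[X in _ - X - _]opprB opprK opprB addrC addrA subrK -mulr2n.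
Qed.

Lemma sa_box2 b w : sa e b -> tp b b w = tp (tp b e b) e w.
Proof. by move=> sb; rewrite (sa_box_comm _ _ sb) subrr subr0. Qed.

Lemma sa_jordan x w : sa e x ->
  tp x e (tp (tp x e x) e w) = tp (tp x e x) e (tp x e w).
Proof.
move=> sx; apply/eqP; rewrite -subr_eq0; apply/eqP/(@mulrn_eq0_lmod _ 2).
have := sa_linJordan w sx sx; rewrite -[X in _ = X *+ _]opprB mulNrn => H.
by rewrite mulrS {1}H addNr.
Qed.

Lemma sa_N x : sa e x -> sa e (- x).
Proof. by move=> [x1 x2]; split; rewrite ?tpNr ?tpNm ?x1 ?x2. Qed.

Lemma sa_U x w :
  tp x (tp e w e) x = tp x e (tp x e w) *+ 2 - tp (tp x e x) e w.
Proof. by rewrite tp_JP3 [tp w e _]tpC addrAC subrr add0r. Qed.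

Lemma sa_Q x y : sa e x -> sa e y -> sa e (tp x y x).
Proof.
move=> sx sy; rewrite -{1}(proj2 sy) sa_U mulr2n.
have sxx := sa_mul sx sx; have sxy := sa_mul sx sy; have sxxy := sa_mul sx sxy.
by apply: sa_D; [apply: sa_D | apply/sa_N/sa_mul].
Qed.

Section Powers.
Variable b : V.
Hypothesis sb : sa e b.

Definition jpow n := iter n (tp b e) e.

Lemma jpowS n : jpow n.+1 = tp b e (jpow n). Proof. by []. Qed.

Lemma jpow1 : jpow 1 = b.
Proof. by rewrite jpowS [tp b e _]tpC; case: sb. Qed.

Lemma sa_jpow n : sa e (jpow n).
Proof. by elim: n => [|n IH]; [exact: sa_e | rewrite jpowS; apply: sa_mul]. Qed.

Lemma jpow2 : jpow 2 = tp b e b.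
Proof. by rewrite jpowS jpow1. Qed.

(** Power associativity, by induction on the degree n = i + j.  Fed with powers
    of b, the linearized Jordan identity and the induction hypothesis give
    b^2 o b^(n-2) = b^n, and then b^(i+1) o b^(j+1) = b^n from
    b^i o b^(j+2) = b^n. *)
Lemma jpowD i j : tp (jpow i) e (jpow j) = jpow (i + j).
Proof.
have P0 k : tp (jpow 0) e (jpow k) = jpow k by case: (sa_jpow k).
have P1 k : tp (jpow 1) e (jpow k) = jpow k.+1 by rewrite jpow1.
move: {2 3}(i + j)%N (erefl (i + j)%N) => n.
elim/ltn_ind: n i j => n IH i j def_n.
case: (ltnP n 3) => [n3|n3].
  move: i j def_n => [|[|[|i]]] [|[|[|j]]] def_n; rewrite -?def_n ?P0 ?P1 //;
    rewrite ?[tp _ e (jpow 0)]tpC ?P0 ?addn0 //;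
    by move: n3; rewrite -def_n ?addSn ?addnS.
have sq2 k : (k.+2 < n)%N -> tp (tp b e b) e (jpow k) = jpow k.+2.
  by move=> kn; rewrite -jpow2 (IH _ kn 2%N k).
have c2 : tp (jpow 2) e (jpow n.-2) = jpow n.
  move: n3 sq2; case: (n) => [|[|[|m]]] // _ sq2.
  by rewrite -[_.-2]/m.+1 jpow2 (jpowS m) -sa_jordan // sq2.
elim: i j def_n => [|i IHi] j def_n; first by rewrite P0 -def_n.
case: j def_n => [|j] def_n.
  by rewrite tpC P0 -def_n addn0.
case: i IHi def_n => [|i] IHi def_n; first by rewrite P1 -def_n.
have := sa_linJordan (jpow j) sb (sa_jpow i.+1).
rewrite -!jpowS sq2; last by rewrite -def_n !addSn !addnS !ltnS leq_addl.
rewrite IHi; last by rewrite -def_n !addSn !addnS.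
have ltn : (i.+1 + j < n)%N by rewrite -def_n !addSn !addnS.
have ltn' : (i.+2 + j < n)%N by rewrite -def_n !addSn !addnS.
rewrite (IH _ ltn i.+1 j erefl) (IH _ ltn' i.+2 j erefl) -jpow2 -jpowS.
have -> : (i.+1 + j = n.-2)%N by rewrite -def_n !addSn !addnS.
have -> : (i.+2 + j).+1 = n by rewrite -def_n !addSn !addnS.
by rewrite c2 subrr => /esym/mulrn_eq0_lmod/eqP; rewrite subr_eq0 => /eqP.
Qed.

Lemma jpow_triple i j k : tp (jpow i) (jpow j) (jpow k) = jpow (i + j + k).
Proof.
rewrite (sa_triple _ _ (sa_jpow j)) !jpowD addnCA addnA [(j + i)%N]addnC.
by rewrite addrK.
Qed.

End Powers.

(** In a Jordan algebra without nilpotents, U_z(b^2) = 0 forces b^2 and z to be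
    orthogonal.  The fundamental formula shows that U_b(z^2), U_z(b) and U_b(z)
    have square zero; the linearized Jordan identity then shows the same for
    u = b o z.  Once u = 0, T_z commutes with L(b,b) = T_(b^2), and
    [sa_box_comm] turns this into L(z,b^2) = L(b^2,z) = 0. *)
Lemma sa_orth (tp_aniso : forall y, tp y y y = 0 -> y = 0) b z w :
  sa e b -> sa e z -> tp z (tp b e b) z = 0 ->
  tp z (tp b e b) w = 0 /\ tp (tp b e b) z w = 0.
Proof.
move=> sb sz; set a := tp b e b => zaz.
have sa_sq0 y : sa e y -> tp y e y = 0 -> y = 0.
  by move=> sy y2; apply: tp_aniso; rewrite sa_box2 // y2 tp0l.
have sa_a : sa e a by apply: sa_mul.
set z2 := tp z e z; have sz2 : sa e z2 by apply: sa_mul.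
have y0 : tp b z2 b = 0.
  apply: sa_sq0; first exact: sa_Q.
  by rewrite tp_fundamental -/a {1 2}/z2 tp_fundamental zaz !tp0m.
have v0 : tp z b z = 0.
  apply: sa_sq0; first exact: sa_Q.
  by rewrite tp_fundamental -/z2 y0 tp0m.
have v0' : tp b z b = 0.
  apply: sa_sq0; first exact: sa_Q.
  by rewrite tp_fundamental -/a zaz tp0m.
set u := tp b e z; have su : sa e u by apply: sa_mul.
(* Each vanishing U-operator turns a double product into a single one. *)
have R1 : tp b e u *+ 2 = tp a e z.
  by rewrite tp_JP3 (proj2 sz) v0' addr0 tpC.
have R2 : tp z e u *+ 2 = tp b e z2.
  by rewrite /u [tp b e z]tpC tp_JP3 (proj2 sb) v0 addr0.
have R3 : tp z e (tp a e z) *+ 2 = tp a e z2.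
  by rewrite [tp a e z]tpC tp_JP3 (proj2 sa_a) zaz addr0.
have R4 : tp b e (tp b e z2) *+ 2 = tp a e z2.
  by rewrite tp_JP3 (proj2 sz2) y0 addr0 tpC.
have u0 : u = 0.
  apply: sa_sq0 => //; apply: (@mulrn_eq0_lmod _ 3).
  have H := sa_linJordan z sb sz; rewrite -/a -/u -/z2 mulrnBl in H.
  have H2 : tp b e (tp u e z) *+ 2 = tp b e (tp b e z2).
    by rewrite -tpMnr [tp u e z]tpC R2.
  have := congr1 (fun x => x *+ 2) H => /=.
  rewrite H2 !mulrnBl R3 R4 -mulrnA [_ z2 *+ 2]mulr2n opprD addrA subrr.
  by move/addIr => <-.
have az0 : tp a e z = 0 by rewrite -R1 u0 tp0r mul0rn.
have comm v : tp z e (tp a e v) = tp a e (tp z e v).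
  rewrite -!sa_box2 //; apply/eqP; rewrite -subr_eq0 tp_comm -sa_box //.
  by rewrite [tp z e b]tpC -/u u0 tp0l tp0m subrr.
split.
  by rewrite (sa_box_comm _ _ sa_a) az0 tp0l comm subrr subrr.
by rewrite (sa_box_comm _ _ sz) [tp z e a]tpC az0 tp0l comm subrr subrr.
Qed.

End Tripotent.

(** * Annihilators and pairs of tripotents *)

(** Orthogonality is symmetric only thanks to positivity; imposing both
    conditions keeps the arguments algebraic. *)
Definition annihilator (a : V) : V -> Prop :=
  fun y => forall w, tp a y w = 0 /\ tp y a w = 0.

Lemma annihilator_tp a x y w :
  annihilator a x -> annihilator a y -> annihilator a (tp x w y).
Proof.
move=> ax ay v; split; apply/eqP; rewrite -oppr_eq0; apply/eqP.
  have := tp_comm w x a y v; rewrite (proj1 (ay _)) (proj1 (ay _)) tp0r subrr.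
  by rewrite [tp w x a]tpC (proj1 (ax _)) tp0l sub0r => <-.
have := tp_comm x w y a v; rewrite (proj2 (ay _)) (proj2 (ay _)) tp0r subrr.
by rewrite [tp w x a]tpC (proj1 (ax _)) tp0m subr0 => <-; rewrite oppr0.
Qed.

Lemma annihilator_Q a x w v : annihilator a x -> tp (tp a w a) x v = 0.
Proof.
move=> ax; have := tp_comm a w a x v.
rewrite (proj1 (ax _)) (proj1 (ax _)) tp0r subrr [tp w a x]tpC.
by rewrite (proj2 (ax _)) tp0m subr0.
Qed.

(** The Peirce spaces E_2(f) and E_0(f) are orthogonal.  Here {f,p,f} = 0, as
    it would be an eigenvector of L(f,f) for the eigenvalue 2 and is also
    Q(f){f,f,p}; the claim then follows by linearizing [tp_JP1] at f. *)
Lemma peirce02 f p w : tp f f f = f -> tp f f p = 0 ->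
  tp f p w = 0 /\ tp p f w = 0.
Proof.
move=> Hf fp; have pf : tp p f f = 0 by rewrite tpC.
have fpf : tp f p f = 0.
  have := tpJ f f f p f; rewrite tp_JP2 fp tp0m Hf subr0 -mulr2n.
  by move/esym/mulrn_eq0_lmod.
split.
  have H := tp_JP1 f p w; rewrite fpf tp0l in H.
  have := tp_JP1 f (f + p) w; rewrite !(tpDl, tpDm, tpDr) Hf fpf fp pf.
  by rewrite -H !(tp0l, tp0m, addr0) -[RHS]addr0 => /addrI.
have H := tp_JP1 p f w; rewrite fpf tp0m in H.
have := tp_JP1 (f + p) f w; rewrite !(tpDl, tpDm, tpDr) Hf fpf fp pf.
by rewrite H !(tp0l, tp0m, addr0) -[LHS]addr0 => /addrI/esym.
Qed.

Section TwoTripotents.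
Variables e f a : V.
Hypotheses (He : tp e e e = e) (Hf : tp f f f = f).
Hypotheses (sea : sa e a) (sfa : sa f a).
Hypothesis eq_sq : tp a e a = tp a f a.

(** L(a,e)^2 = (L(s,e) + Q(a)Q(e)) / 2, where s is the common square, and both
    L(s,e) and Q(a)Q(e) send e and f to s. *)
Lemma tripotents_sq0 : tp a e (tp a e (e - f)) = 0.
Proof.
set s := tp a e a; have ses : sa e s by apply: sa_mul.
have sfs : sa f s by rewrite /s eq_sq; apply: sa_mul.
(* Q(e)^3 = Q(e) and Q(a) = Q(e)Q(a)Q(e): Q(a) maps into E_2(e). *)
have Qe x : tp e (tp e (tp e x e) e) e = tp e x e.
  by rewrite -tp_fundamental He.
have QaE w : tp a w a = tp e (tp a (tp e w e) a) e.
  by rewrite -tp_fundamental (proj2 sea).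
have Qf : tp a (tp e f e) a = s.
  have H : tp e (tp a (tp e f e) a) e = s by rewrite -QaE -eq_sq.
  have : tp e (tp e (tp a (tp e f e) a) e) e = tp a (tp e f e) a.
    by rewrite (QaE (tp e f e)) Qe.
  by rewrite H (proj2 ses).
have sqe : tp a e (tp a e e) = s by rewrite [tp a e e]tpC (proj1 sea).
have sqf : tp a e (tp a e f) = s.
  apply: (@mulrn_inj_lmod 1); rewrite tp_JP3 Qf.
  by rewrite tpC -(sa_box2 f sea) (sa_box2 f sfa) -eq_sq tpC (proj1 sfs) mulr2n.
by rewrite !tpBr sqe sqf subrr.
Qed.

Let box_ediff w : tp (e - f) a w = tp a (e - f) w.
Proof. by rewrite tpBl tpBm -(sa_box He _ sea) -(sa_box Hf _ sfa). Qed.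

Let Qediff : tp a (e - f) a = 0.
Proof. by rewrite tpBm eq_sq subrr. Qed.

(** Computing [L(a,e), L(a,e-f)] as it stands, and again after exchanging the
    arguments of both box operators, gives two values that differ by a sign. *)
Lemma tripotents_box_comm w : tp a e (e - f) = 0 ->
  tp a e (tp a (e - f) w) = tp a (e - f) (tp a e w).
Proof.
move=> aez; set s := tp a e a; set z := e - f.
have ses : sa e s by apply: sa_mul.
have sfs : sa f s by rewrite /s eq_sq; apply: sa_mul.
have eaz : tp e a z = 0 by rewrite -sa_box.
have sz : tp s z w = tp z s w.
  by rewrite /z tpBl tpBm (sa_box He _ ses) (sa_box Hf _ sfs).
have H1 := tp_comm a e a z w; rewrite eaz tp0m subr0 -/s sz in H1.
have H2 := tp_comm e a z a w.
rewrite eaz tp0l sub0r -/s !box_ediff -!(sa_box He _ sea) H1 in H2.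
apply/eqP; rewrite -subr_eq0 H1; apply/eqP/(@mulrn_eq0_lmod _ 1).
by rewrite mulr2n {1}H2 addNr.
Qed.

(** With H = L(a,e-f), [tp_JP3] gives 2 H^2 = Q(a)Q(e-f) because
    Q(a)(e-f) = 0, and H Q(a) = 0 by [tp_JP2] for the same reason. *)
Lemma tripotents_box_nilp w :
  tp a (e - f) (tp a (e - f) (tp a (e - f) w)) = 0.
Proof.
apply: (@mulrn_eq0_lmod _ 1); rewrite -tpMnr tp_JP3 Qediff tp0r add0r.
by rewrite tp_JP2 [tp (e - f) a _]tpC -tp_JP2 Qediff tp0r.
Qed.

Lemma sub_tripotents_annihilator :
  (forall w, tp a (e - f) w = 0) -> annihilator a (e - f).
Proof. by move=> H w; rewrite box_ediff. Qed.

End TwoTripotents.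
End JordanTriple.

(** * Real-valued norms over the complex numbers *)

Section RealNorm.
Variable R : realType.

(** Norms over R[i] take values in the partially ordered field R[i]; taking
    real parts loses nothing, see [rnormE], and makes them totally ordered. *)
Definition rnorm (W : normedZmodType R[i]) (x : W) : R := complex.Re `|x|.

Lemma rnormE (W : normedZmodType R[i]) (x : W) : `|x| = (rnorm x)%:C.
Proof.
have := normr_ge0 x; rewrite /rnorm; case: `|x| => u v.
by rewrite lecE /= => /andP[/eqP -> _].
Qed.

Lemma rnorm_ge0 (W : normedZmodType R[i]) (x : W) : 0 <= rnorm x.
Proof. by rewrite -lecR -rnormE normr_ge0. Qed.

Lemma rnormD (W : normedZmodType R[i]) (x y : W) :
  rnorm (x + y) <= rnorm x + rnorm y.
Proof. by rewrite -lecR rmorphD /= -!rnormE ler_normD. Qed.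

Lemma rnorm_eq0 (W : normedZmodType R[i]) (x : W) : rnorm x = 0 -> x = 0.
Proof. by move=> x0; apply/eqP; rewrite -normr_eq0 rnormE x0. Qed.

Lemma rnormN (W : normedZmodType R[i]) (x : W) : rnorm (- x) = rnorm x.
Proof. by rewrite /rnorm normrN. Qed.

Lemma rnorm0 (W : normedZmodType R[i]) : rnorm (0 : W) = 0.
Proof. by rewrite /rnorm normr0. Qed.

Lemma rnorm1 : rnorm (1 : R[i]) = 1.
Proof. by rewrite /rnorm normr1. Qed.

Lemma rnorm_sum (W : normedZmodType R[i]) (I : Type) (r : seq I) (u : I -> W) :
  rnorm (\sum_(k <- r) u k) <= \sum_(k <- r) rnorm (u k).
Proof.
elim/big_ind2: _ => //; first by rewrite rnorm0.
by move=> x a y b xa yb; rewrite (le_trans (rnormD _ _)) // lerD.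
Qed.

Lemma rnormZ (W : normedModType R[i]) (k : R[i]) (x : W) :
  rnorm (k *: x) = rnorm k * rnorm x.
Proof.
by apply: complexI; rewrite rmorphM /= -!rnormE normrZ.
Qed.

Lemma rnormM (k l : R[i]) : rnorm (k * l) = rnorm k * rnorm l.
Proof. by apply: complexI; rewrite rmorphM /= -!rnormE normrM. Qed.

Lemma rnormR (r : R) : rnorm (r%:C) = `|r|.
Proof.
by apply: complexI; rewrite -rnormE normc_def /= expr0n addr0 sqrtr_sqr.
Qed.

Lemma rnorm_half : rnorm (2^-1 : R[i]) = 2^-1.
Proof.
have -> : (2^-1 : R[i]) = (2^-1 : R)%:C by rewrite fmorphV rmorph_nat.
by rewrite rnormR ger0_norm // invr_ge0.
Qed.

Lemma rnorm_sqr (z : R[i]) :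
  rnorm z ^+ 2 = complex.Re z ^+ 2 + complex.Im z ^+ 2.
Proof.
case: z => a b; rewrite /rnorm normc_def /= sqr_sqrtr //.
by rewrite addr_ge0 ?sqr_ge0.
Qed.

(** Removes the constant M from a bound that persists under cubing. *)
Lemma pow3_le (x y M : R) : 0 <= x -> 0 <= y ->
  (forall k, x ^+ (3 ^ k) <= M * y ^+ (3 ^ k)) -> x <= y.
Proof.
move=> x0 y0 H; rewrite leNgt; apply/negP => yx.
have [y00|yn0] := eqVneq y 0.
  have := H 0%N; rewrite expn0 !expr1 y00 mulr0 => xle.
  by move: yx; rewrite y00 ltNge xle.
have yp : 0 < y by rewrite lt_neqAle eq_sym yn0.
pose h := x / y - 1.
have hp : 0 < h by rewrite subr_gt0 ltr_pdivlMr // mul1r.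
have bern n : 1 + n%:R * h <= (1 + h) ^+ n.
  elim: n => [|n IH]; first by rewrite mul0r addr0 expr0.
  rewrite exprS; apply: le_trans (_ : (1 + h) * (1 + n%:R * h) <= _).
    rewrite -natr1; have : 0 <= n%:R * h ^+ 2 by rewrite mulr_ge0 ?sqr_ge0.
    by nra.
  by rewrite ler_pM2l // addr_gt0.
have bd k : k%:R * h <= M.
  have : (1 + h) ^+ (3 ^ k) <= M.
    by rewrite /h addrCA subrr addr0 expr_div_n ler_pdivrMr ?exprn_gt0.
  have := bern (3 ^ k)%N; have : (k%:R : R) <= (3 ^ k)%:R.
    by rewrite ler_nat ltnW // ltn_expl.
  by nra.
have := bd (Num.trunc (M / h)).+1; apply/negP; rewrite -ltNge.
rewrite -ltr_pdivrMr //; apply: truncnS_gt.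
Qed.

End RealNorm.

(** * Commutative C*-seminorms on polynomials *)

Section CstarSeminorm.
Variables (R : realType) (N : {poly R[i]} -> R) (M : R).
Local Notation conjp := (map_poly (@Num.conj R[i])).

(** The properties inherited by the polynomials in a self-adjoint element of
    E_2(e): the cube axiom of the triple, and boundedness of the product. *)
Record cstar_seminorm : Prop := CstarSeminorm {
  csn_ge0 : forall p, 0 <= N p;
  csn_1 : N 1 <= 1;
  csnD : forall p q, N (p + q) <= N p + N q;
  csnZ : forall c p, N (c *: p) = rnorm c * N p;
  csn_cube : forall p, N (p * conjp p * p) = N p ^+ 3;
  csn_bounded : 0 <= M /\ forall p q, N (p * q) <= M * (N p * N q) }.

Hypothesis HN : cstar_seminorm.

Let N0 p : 0 <= N p. Proof. exact: csn_ge0. Qed.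

Lemma csnN p : N (- p) = N p.
Proof. by rewrite -scaleN1r csnZ // rnormN rnorm1 mul1r. Qed.

Lemma csn0 : N 0 = 0.
Proof. by rewrite -(scale0r (0 : {poly R[i]})) csnZ // rnorm0 mul0r. Qed.

Lemma csnB p q : N (p - q) <= N p + N q.
Proof. by rewrite -(csnN q) csnD. Qed.

Lemma conjpK p : conjp (conjp p) = p.
Proof. by rewrite -map_poly_comp map_poly_id // => c _ /=; rewrite conjCK. Qed.

(** The map t : p |-> p conj(p) p is multiplicative and cubes N, so iterating t
    in the bound N(p q) <= M N(p) N(q) brings the constant down to 1. *)
Lemma csnM p q : N (p * q) <= N p * N q.
Proof.
pose t (p : {poly R[i]}) := p * conjp p * p.
have tM a b : t (a * b) = t a * t b by rewrite /t rmorphM; ring.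
have tk k a : N (iter k t a) = N a ^+ (3 ^ k).
  elim: k => [|k IH]; first by rewrite expn0 expr1.
  by rewrite iterS csn_cube // IH -exprM expnSr.
have tkM k a b : iter k t (a * b) = iter k t a * iter k t b.
  by elim: k => //= k ->; rewrite tM.
have [M0 HM] := csn_bounded HN.
apply: (@pow3_le _ _ _ M) => [||k]; rewrite ?mulr_ge0 //.
by rewrite -tk tkM exprMn -!tk HM.
Qed.

Lemma csn_sq_conj p : N (p * conjp p) = N p ^+ 2.
Proof.
have H q : N q ^+ 2 <= N (q * conjp q).
  have [->|q0] := eqVneq (N q) 0; first by rewrite expr0n.
  rewrite -(@ler_pM2r _ (N q)) ?lt_neqAle ?(eq_sym 0) ?q0 ?N0 //.
  by rewrite -exprSr -csn_cube // csnM.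
have le q : N q <= N (conjp q).
  have [->|q0] := eqVneq (N q) 0; first by rewrite N0.
  rewrite -(@ler_pM2l _ (N q)) ?lt_neqAle ?(eq_sym 0) ?q0 ?N0 //.
  by rewrite -expr2 (le_trans (H q)) // csnM.
have eqN : N (conjp p) = N p.
  by apply/le_anti; rewrite le -{2}(conjpK p) le.
by apply/le_anti; rewrite H andbT (le_trans (csnM _ _)) // eqN.
Qed.

Lemma csn_conj p : N (conjp p) = N p.
Proof.
apply/eqP; rewrite -(@eqrXn2 _ 2) ?N0 //; apply/eqP.
by rewrite -!csn_sq_conj conjpK mulrC.
Qed.

Lemma csnX p n : N (p ^+ n) <= N p ^+ n.
Proof.
elim: n => [|n IH]; first by rewrite !expr0 csn_1.
by rewrite !exprS (le_trans (csnM _ _)) // ler_wpM2l.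
Qed.

(** p is the real part of p + i q, and p^2 + q^2 = (p + i q)(p - i q). *)
Lemma csn_sqD (p q : {poly R[i]}) : conjp p = p -> conjp q = q ->
  N (p ^+ 2) <= N (p ^+ 2 + q ^+ 2).
Proof.
move=> pr qr; pose u := p + 'i%R *: q.
have cu : conjp u = p - 'i%R *: q.
  rewrite /u rmorphD /= map_polyZ pr qr -scaleNr; congr (_ + _ *: _).
  exact: conjCi.
have -> : p ^+ 2 + q ^+ 2 = u * conjp u.
  rewrite cu /u -!mul_polyC.
  have i2 : ('i%R%:P : {poly R[i]}) * 'i%R%:P = -1.
    by rewrite -polyCM -expr2 sqrCi polyCN.
  transitivity (p ^+ 2 - ('i%R%:P * 'i%R%:P) * q ^+ 2); last by ring.
  by rewrite i2 mulN1r opprK.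
rewrite csn_sq_conj expr2 (le_trans (csnM _ _)) // -expr2.
have half : p = 2^-1 *: (u + conjp u).
  have h2 : 2^-1 + 2^-1 = 1 :> R[i] by rewrite [RHS]splitr mul1r.
  by rewrite cu /u addrACA subrr addr0 scalerDr -scalerDl h2 scale1r.
suff : N p <= N u by move=> pu; rewrite ler_pXn2r // nnegrE.
rewrite {1}half csnZ //.
rewrite rnorm_half ler_pdivrMl // mulr_natl mulr2n (le_trans (csnD HN _ _)) //.
by rewrite csn_conj.
Qed.

(** Squares are positive.  The simplified Newton iteration
    h |-> h - (h^2 - (1 - p^2)) / 2 started at 1 yields real h with 1 - p^2
    arbitrarily close to h^2, and N(h^2) <= N(h^2 + p^2), which is close to
    N(1). *)
Lemma csn_1Bsq (p : {poly R[i]}) : conjp p = p -> N (p ^+ 2) <= 4^-1 ->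
  N (1 - p ^+ 2) <= 1.
Proof.
move=> pr px; set x := p ^+ 2 in px *.
pose c : R[i] := 2^-1.
have c2 : c%:P + c%:P = 1 :> {poly R[i]}.
  by rewrite -polyCD; congr polyC; rewrite [RHS]splitr mul1r.
pose h k := iter k (fun g => g - c *: (g ^+ 2 - (1 - x))) 1.
pose eps k := h k ^+ 2 - (1 - x).
have hS k : h k.+1 = h k - c%:P * eps k by rewrite mul_polyC.
have conj_eps k : conjp (h k) = h k -> conjp (eps k) = eps k.
  by move=> hk; rewrite /eps !rmorphB rmorph1 /x !rmorphXn /= hk pr.
have hr k : conjp (h k) = h k.
  elim: k => [|k IH]; first by rewrite rmorph1.
  rewrite hS rmorphB rmorphM /= IH conj_eps // map_polyC /=.
  by congr (_ - _%:P * _); rewrite fmorphV rmorph_nat.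
have epsS k : eps k.+1 = eps k * (1 - h k) + c%:P * (c%:P * eps k ^+ 2).
  transitivity (eps k - (c%:P + c%:P) * h k * eps k
                + c%:P * (c%:P * eps k ^+ 2)); last by rewrite c2; ring.
  by rewrite {1}/eps hS /eps; ring.
pose q k : R := 2^-1 ^+ k.
have q0 k : 0 < q k by rewrite exprn_gt0 // invr_gt0.
have qS k : q k.+1 = q k / 2 by rewrite /q exprSr.
have bnd k : N (1 - h k) <= 4^-1 * (1 - q k) /\ N (eps k) <= 4^-1 * q k.
  elim: k => [|k [IH1 IH2]].
    have h0 : h 0%N = 1 by [].
    rewrite /eps h0 subrr csn0 expr1n subKr /q expr0 subrr.
    by rewrite mulr0 mulr1.
  have Hc r : N (c%:P * r) = 2^-1 * N r by rewrite mul_polyC csnZ // rnorm_half.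
  split.
    rewrite hS opprB addrCA addrC (le_trans (csnD HN _ _)) // Hc qS.
    by lra.
  rewrite epsS (le_trans (csnD HN _ _)) // !Hc qS.
  have := csnM (eps k) (1 - h k); have := csnX (eps k) 2.
  have := N0 (eps k); have := N0 (1 - h k); have := q0 k.
  by nra.
have concl k : N (1 - x) <= 1 + q k.
  have -> : 1 - x = h k ^+ 2 - eps k by rewrite /eps subKr.
  apply: le_trans (csnB _ _) _.
  have : N (h k ^+ 2) <= 1 + N (eps k).
    apply: le_trans (csn_sqD (hr k) pr) _.
    have -> : h k ^+ 2 + p ^+ 2 = 1 + eps k by rewrite /eps -/x; ring.
    by rewrite (le_trans (csnD HN _ _)) // lerD2r csn_1.
  have := (bnd k).2; have := q0 k; lra.
rewrite leNgt; apply/negP => gt1.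
pose d := N (1 - x) - 1; have d0 : 0 < d by rewrite subr_gt0.
have := concl (Num.trunc d^-1).+1; apply/negP; rewrite -ltNge.
set k := _.+1; rewrite -ltrBrDl -/d /q exprVn invf_plt ?posrE ?exprn_gt0 //.
apply: lt_le_trans (truncnS_gt _) _; rewrite -natrX ler_nat ltnW //.
exact: ltn_expl.
Qed.

Lemma expr_1DV_le (n : nat) : (1 + n.+1%:R^-1) ^+ n.+1 <= expR 1 :> R.
Proof.
have -> : expR 1 = expR (n.+1%:R^-1) ^+ n.+1 :> R.
  by rewrite -expRM_natl mulfV // pnatr_eq0.
by rewrite ler_pXn2r ?nnegrE ?expR_ge0 ?addr_ge0 ?invr_ge0 ?expR_ge1Dx.
Qed.

(** With n = (m+1)^2 and x = X^2 one has
    |1 - z x|^2 = 1 - 2 Re(z) x + |z|^2 x^2; the part 1 - 2 Re(z) x has N at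
    most 1 because x is a square and Re z >= 0, and the rest is at most 1/n. *)
Lemma csn_bound (m : nat) (z : R[i]) : N 'X^2 <= 8^-1 ->
  0 <= complex.Re z -> rnorm z = m.+1%:R^-1 ->
  N ((1 - z *: 'X^2) ^+ (m.+1 ^ 2)) <= expR 1.
Proof.
move=> NX z0 nz; set n := (m.+1 ^ 2)%N.
pose a := complex.Re z; pose sg := Num.sqrt (a *+ 2).
have a1 : a <= 1.
  have : a ^+ 2 <= 1.
    rewrite (@le_trans _ _ (rnorm z ^+ 2)) //.
      by rewrite rnorm_sqr lerDl sqr_ge0.
    by rewrite nz exprn_ile1 ?invr_ge0 // invf_le1 ?ltr0n // ler1n.
  by rewrite -[X in _ <= X](expr1n _ 2) ler_pXn2r ?nnegrE.
have sg2 : sg ^+ 2 = a *+ 2 by rewrite sqr_sqrtr // mulrn_wge0.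
pose y : {poly R[i]} := (sg%:C) *: 'X.
have yr : conjp y = y.
  by rewrite /y map_polyZ map_polyX; congr (_ *: _); apply: conjc_real.
have y2 : y ^+ 2 = (a *+ 2)%:C *: 'X^2 by rewrite /y exprZn -rmorphXn /= sg2.
have Ny : N (1 - y ^+ 2) <= 1.
  apply: csn_1Bsq => //; rewrite y2 csnZ // rnormR ger0_norm ?mulrn_wge0 //.
  rewrite -mulr_natl; have := N0 'X^2; have := z0; rewrite -/a; nra.
have prodE : (1 - z *: 'X^2) * conjp (1 - z *: 'X^2)
    = (1 - y ^+ 2) + (rnorm z ^+ 2)%:C *: 'X^2 ^+ 2.
  rewrite rmorphB rmorph1 /= map_polyZ map_polyXn y2 -!mul_polyC.
  have -> : (a *+ 2)%:C = z + Num.conj z.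
    apply/eqP; rewrite eq_complex /a; case: (z) => u v /=.
    by rewrite subrr mulr2n !eqxx.
  have -> : (rnorm z ^+ 2)%:C = z * Num.conj z.
    rewrite rnorm_sqr; apply/eqP; rewrite eq_complex; case: (z) => u v /=.
    by apply/andP; split; apply/eqP; ring.
  by rewrite !polyCD !polyCM; ring.
have prod_le : N ((1 - z *: 'X^2) * conjp (1 - z *: 'X^2)) <= 1 + n%:R^-1.
  rewrite prodE (le_trans (csnD HN _ _)) // lerD // csnZ // rnormR.
  rewrite ger0_norm ?sqr_ge0 // nz exprVn -natrX -[leRHS]mulr1.
  rewrite ler_wpM2l ?invr_ge0 // (le_trans (csnX _ _)) //.
  by rewrite exprn_ile1 // (le_trans NX) // invf_le1 // ler1n.
have e1 : 1 <= expR 1 :> R by rewrite -expR0 ler_expR.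
rewrite -(@ler_pXn2r _ 2) ?nnegrE ?expR_ge0 // -csn_sq_conj rmorphXn /= -exprMn.
apply: le_trans (csnX _ _) _; apply: (@le_trans _ _ (expR 1)).
  apply: le_trans (expr_1DV_le (n.-1)).
  by rewrite prednK ?expn_gt0 // ler_pXn2r ?nnegrE ?N0 // addr_ge0 ?invr_ge0.
by rewrite expr2 ler_peMr // expR_ge0.
Qed.

End CstarSeminorm.

(** * Cauchy's estimate for vector-valued polynomials *)

Section CauchyEstimate.
Variables (R : realType) (W : normedModType R[i]).

Lemma prim_root_exists (n : nat) : (0 < n)%N ->
  exists w : R[i], n.-primitive_root w.
Proof.
move=> n0; pose p : {poly R[i]} := 'X^n - 1.
have [rs def_p] := closed_field_poly_normal p.
rewrite (monicP _) ?monicXnsubC // scale1r in def_p.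
have rn1 : all n.-unity_root rs.
  by apply/allP => z; rewrite -root_prod_XsubC -def_p.
have sz : (n < (size rs).+1)%N.
  by rewrite -(size_prod_XsubC rs id) -def_p size_XnsubC.
have [|z _ pz] := hasP (has_prim_root n0 rn1 _ sz); last by exists z.
by rewrite -separable_prod_XsubC -def_p separable_Xn_sub_1 // pnatr_eq0 -lt0n.
Qed.

(** The contour integral is replaced by an average over the roots of unity of
    order n + 1, which is exact on polynomials of degree n. *)
Lemma cauchy_estimate (n : nat) (v : nat -> W) (r B : R) : 0 < r ->
  (0 < n)%N ->
  (forall z, rnorm z = r -> rnorm (\sum_(k < n.+1) z ^+ k *: v k) <= B) ->
  r * rnorm (v 1%N) <= B.
Proof.
move=> r0 n0 bnd; have [w pw] := prim_root_exists (ltn0Sn n).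
have w1 := prim_expr_order pw.
have nw j : rnorm (w ^+ j) = 1.
  have XN (x : R[i]) k : rnorm (x ^+ k) = rnorm x ^+ k.
    by elim: k => [|k IH]; rewrite ?expr0 ?rnorm1 // !exprS rnormM IH.
  rewrite XN; suff -> : rnorm w = 1 by rewrite expr1n.
  have : rnorm w ^+ n.+1 == 1 by rewrite -XN w1 rnorm1.
  by rewrite -[X in _ == X](expr1n _ n.+1) eqrXn2 ?rnorm_ge0 // => /eqP.
have sumw m : \sum_(j < n.+1) (w ^+ m) ^+ j =
    (if (n.+1 %| m)%N then n.+1%:R else 0).
  rewrite (prim_order_dvd pw); case: eqP => [->|wm].
    by under eq_bigr do rewrite expr1n; rewrite sumr_const card_ord.
  apply/eqP; have := subrX1 (w ^+ m) n.+1; rewrite exprAC w1 expr1n subrr.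
  by move/esym/eqP; rewrite mulf_eq0 subr_eq0 => /orP[/eqP|].
pose F z : W := \sum_(k < n.+1) z ^+ k *: v k.
(* The weight w^(j n) stands for w^(-j). *)
have sumF : \sum_(j < n.+1) w ^+ (j * n) *: F (r%:C * w ^+ j)
    = (n.+1%:R * r%:C) *: v 1%N.
  under eq_bigr do rewrite /F scaler_sumr.
  rewrite exchange_big /=.
  transitivity (\sum_(k < n.+1)
      (r%:C ^+ k * (if (n.+1 %| n + k)%N then n.+1%:R else 0)) *: v k).
    apply: eq_bigr => k _; rewrite -sumw mulr_sumr scaler_suml.
    apply: eq_bigr => j _; rewrite scalerA; congr (_ *: _).
    by rewrite exprMn mulrCA -!exprM -exprD -mulnDr mulnC.
  have k1 : (1 < n.+1)%N by [].
  rewrite (bigD1 (Ordinal k1)) //= big1 ?addr0.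
    by rewrite addn1 dvdnn expr1 mulrC.
  move=> k; rewrite -val_eqE /= => kn1.
  case: dvdnP => [[q Hq]|_]; last by rewrite mulr0 scale0r.
  have kn := ltn_ord k; exfalso.
  by case: q Hq => [|[|q]] Hq; move: n0 kn kn1 Hq; lia.
have nN : 0 < (n.+1%:R : R) by rewrite ltr0n.
rewrite -(ler_pM2l nN).
have := congr1 (@rnorm R W) sumF.
rewrite rnormZ rnormM rnormR (ger0_norm (ltW r0)).
have -> : rnorm (n.+1%:R : R[i]) = n.+1%:R.
  by rewrite -(rmorph_nat (real_complex R)) rnormR ger0_norm // ler0n.
rewrite mulrA => <-.
apply: le_trans (rnorm_sum _ _) _.
rewrite mulr_natl -[n.+1 in leRHS]card_ord -sumr_const ler_sum // => j _.
rewrite rnormZ nw mul1r; apply: bnd.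
by rewrite rnormM nw mulr1 rnormR ger0_norm // ltW.
Qed.
End CauchyEstimate.

(** * Exponentials of hermitian operators *)

Section HermitianExp.
Variables (R : realType) (E : completeNormedModType R[i]).
Implicit Types A B H T : E -> E.

Let ecoef (t : R) n : R[i] := (t *i) ^+ n / n`!%:R.

Definition bounded_linear T : Prop :=
  [/\ forall x y, T (x + y) = T x + T y,
      forall k x, T (k *: x) = k *: T x
    & exists M, 0 <= M /\ forall x, rnorm (T x) <= M * rnorm x].

Lemma rnormX (z : R[i]) n : rnorm (z ^+ n) = rnorm z ^+ n.
Proof. by elim: n => [|k IH]; rewrite ?expr0 ?rnorm1 // !exprS rnormM IH. Qed.

Lemma rnorm_ecoef t n : rnorm (ecoef t n) = `|t| ^+ n / n`!%:R.
Proof.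
rewrite rnormM rnormX; congr (_ ^+ _ * _).
  by rewrite /rnorm normc_def /= expr0n add0r sqrtr_sqr.
have -> : (n`!%:R^-1 : R[i]) = (n`!%:R^-1 : R)%:C by rewrite fmorphV rmorph_nat.
by rewrite rnormR ger0_norm // invr_ge0.
Qed.

Lemma exp_itT_cvg T (t : R) (z : E) : bounded_linear T ->
  cvgn (series (fun n => ecoef t n *: iter n T z)).
Proof.
move=> [TD TZ [M [M0 HM]]].
have iterT n : rnorm (iter n T z) <= M ^+ n * rnorm z.
  elim: n => [|n IH]; first by rewrite expr0 mul1r.
  by rewrite iterS (le_trans (HM _)) // exprS -mulrA ler_wpM2l.
apply/cauchy_cvgP/cauchy_seriesP => e e0.
have [d d0 ed] : exists2 d : R, 0 < d & e = d%:C.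
  move: e0; case: e => u v; rewrite ltcE /= => /andP[/eqP -> u0].
  by exists u.
have d1 : 0 < d / (rnorm z + 1) by rewrite divr_gt0 // ltr_wpDl // rnorm_ge0.
have := is_cvg_series_exp_coeff (`|t| * M).
move/cauchy_cvgP/cauchy_seriesP => /(_ _ d1); apply: filterS => -[p q] /= H.
rewrite ed rnormE ltcR.
apply: (@le_lt_trans _ _
  ((\sum_(p <= k < q) exp_coeff (`|t| * M) k) * rnorm z)).
  rewrite mulr_suml; apply: le_trans (rnorm_sum _ _) _.
  apply: ler_sum => k _; rewrite rnormZ rnorm_ecoef /exp_coeff /= exprMn.
  have := iterT k; have : 0 <= `|t| ^+ k / k`!%:R.
    by rewrite divr_ge0 ?exprn_ge0.
  move=> h0 h1; apply: le_trans (ler_wpM2l h0 h1) _.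
  by rewrite mulrA [_ * M ^+ k]mulrAC.
have H' := le_lt_trans (ler_norm _) H.
have z0 := rnorm_ge0 z.
move: H'; rewrite ltr_pdivlMr ?ltr_wpDl //.
have : 0 <= \sum_(p <= k < q) exp_coeff (`|t| * M) k.
  apply: sumr_ge0 => k _.
  by rewrite /exp_coeff /= divr_ge0 ?exprn_ge0 ?mulr_ge0.
by nra.
Qed.

(** The binomial formula for (B + H)^n w, cut after the linear term. *)
Lemma iterD_nilp A B H w n :
  (forall x, A x = B x + H x) -> (forall x, B (H x) = H (B x)) ->
  (forall x y, B (x + y) = B x + B y) -> (forall x y, H (x + y) = H x + H y) ->
  H (H w) = 0 ->
  iter n A w = iter n B w + iter n.-1 B (H w) *+ n.
Proof.
move=> AE BH BD HD HHw.
have B0 : B 0 = 0 by apply: (addrI (B 0)); rewrite -BD !addr0.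
have H0 : H 0 = 0 by apply: (addrI (H 0)); rewrite -HD !addr0.
have HM x k : H (x *+ k) = H x *+ k.
  by elim: k => [|k IH]; rewrite ?mulr0n // !mulrS HD IH.
have BM x k : B (x *+ k) = B x *+ k.
  by elim: k => [|k IH]; rewrite ?mulr0n // !mulrS BD IH.
have Hiter x k : H (iter k B x) = iter k B (H x).
  by elim: k => //= k IH; rewrite -BH IH.
have iter0 k : iter k B 0 = 0 by elim: k => //= k ->.
elim: n => [|n IH]; first by rewrite addr0.
rewrite iterS IH AE BD HD HM !Hiter HHw iter0 mul0rn addr0 BM -!iterS.
case: n {IH} => [|n]; first by rewrite mulr0n addr0.
by rewrite -addrA -[X in _ + (_ + X)]mulr1n -mulrnDr addn1.
Qed.

Lemma exp_itT_nilp A B H t w :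
  (forall x, A x = B x + H x) -> (forall x, B (H x) = H (B x)) ->
  bounded_linear B -> (forall x y, H (x + y) = H x + H y) ->
  H (H w) = 0 ->
  exp_itT A t w = exp_itT B t (w + (t *i) *: H w).
Proof.
move=> AE BH BL HD HHw; have [BD BZ _] := BL.
have cB x := @exp_itT_cvg B t x BL.
have iterB_D k x y : iter k B (x + y) = iter k B x + iter k B y.
  by elim: k => //= k ->; rewrite BD.
have iterB_Z k c x : iter k B (c *: x) = c *: iter k B x.
  by elim: k => //= k ->; rewrite BZ.
pose S T x := series (fun n => ecoef t n *: iter n T x).
have SE n : S A w n.+1 = S B w n.+1 + (t *i) *: S B (H w) n.
  rewrite /S /series /= scaler_sumr big_nat_recl // [in RHS]big_nat_recl //=.
  rewrite -addrA; congr (_ + _); rewrite -big_split /=.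
  apply: eq_bigr => k _; rewrite -!iterS (@iterD_nilp A B H) // scalerDr.
  congr (_ + _); rewrite scalerA -scaler_nat scalerA; congr (_ *: _).
  rewrite /ecoef exprS factS natrM invfM -!mulrA; congr (_ * (_ * _)).
  by rewrite mulrCA mulVf ?mulr1 // pnatr_eq0.
rewrite /exp_itT; apply/cvg_lim => //; rewrite -cvg_shiftS.
have -> : [sequence S A w n.+1]_n =
    (fun n => S B w n.+1 + (t *i) *: S B (H w) n).
  by apply/funext => n; rewrite /= SE.
have SBD : S B (w + (t *i) *: H w) =
    (fun n => S B w n + (t *i) *: S B (H w) n).
  apply/funext => n; rewrite /S /series /= scaler_sumr -big_split /=.
  by apply: eq_bigr => k _; rewrite iterB_D iterB_Z scalerDr !scalerA mulrC.
have c1 : S B w @ \oo --> limn (S B w) by exact: cB.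
have c2 : (fun n => (t *i) *: S B (H w) n) @ \oo
    --> (t *i) *: limn (S B (H w)) by apply: cvgZl_tmp; exact: cB.
have -> : limn (S B (w + (t *i) *: H w))
    = limn (S B w) + (t *i) *: limn (S B (H w)).
  by apply/cvg_lim => //; rewrite SBD; apply: cvgD.
by apply: cvgD => //; rewrite cvg_shiftS.
Qed.

(** Since exp(itA) w = exp(itB)(w + it H w) and both exponentials are
    isometries, w + it H w has norm |w| for every real t. *)
Lemma hermitian_nilp A B H w :
  (forall x, A x = B x + H x) -> (forall x, B (H x) = H (B x)) ->
  bounded_linear B -> (forall x y, H (x + y) = H x + H y) ->
  hermitian_op A -> hermitian_op B ->
  H (H w) = 0 -> H w = 0.
Proof.
move=> AE BH BL HD hA hB HHw; apply/eqP; rewrite -normr_eq0 rnormE.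
have nE t : rnorm (w + (t *i) *: H w) = rnorm w.
  by rewrite /rnorm -(hB t) -(exp_itT_nilp t AE) // hA.
have bd (t : R) : `|t| * rnorm (H w) <= rnorm w + rnorm w.
  have -> : `|t| = rnorm (t *i).
    by rewrite /rnorm normc_def /= expr0n add0r sqrtr_sqr.
  rewrite -rnormZ -{1}(nE t) -(rnormN w).
  by rewrite -{1}[_ *: _](addrK w) [_ + w]addrC rnormD.
rewrite -(rmorph0 (real_complex R)) (inj_eq (@complexI _)).
rewrite eq_le rnorm_ge0 andbT leNgt; apply/negP => h0.
have := bd ((rnorm w + rnorm w) / rnorm (H w) + 1).
rewrite ger0_norm ?addr_ge0 ?divr_ge0 ?addr_ge0 ?rnorm_ge0 //.
by rewrite mulrDl divfK ?gt_eqF // mul1r gerDl leNgt h0.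
Qed.

End HermitianExp.

(** * JB*-triples *)

Section JBstar.
Variables (R : realType) (E : completeNormedModType R[i]).
Variable tp : E -> E -> E -> E.
Hypothesis Hjb : is_JBstar_triple tp.

Lemma jb_addl a a' b c : tp (a + a') b c = tp a b c + tp a' b c.
Proof. by have := jbt_linear Hjb 1 a a' b c; rewrite !scale1r. Qed.

Lemma jb_addm a b b' c : tp a (b + b') c = tp a b c + tp a b' c.
Proof.
have := jbt_antilinear Hjb 1 a b b' c.
have -> : Num.conj (1 : R[i]) = 1 by exact: rmorph1.
by rewrite scale1r => ->; rewrite scale1r.
Qed.

Lemma JBstar_jordan_triple : jordan_triple tp.
Proof.
split; [exact: jbt_sym | exact: jb_addl | exact: jb_addm | exact: jbt_jordan].
Qed.
Local Notation Jt := JBstar_jordan_triple.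

Lemma jb_scalel k a b c : tp (k *: a) b c = k *: tp a b c.
Proof. by have := jbt_linear Hjb k a 0 b c; rewrite !addr0 (tp0l Jt) addr0. Qed.

Lemma jb_scalem k a b c : tp a (k *: b) c = Num.conj k *: tp a b c.
Proof.
by have := jbt_antilinear Hjb k a b 0 c; rewrite !addr0 (tp0m Jt) addr0.
Qed.

Lemma jb_scaler k a b c : tp a b (k *: c) = k *: tp a b c.
Proof. by rewrite (tpC Jt) jb_scalel (tpC Jt). Qed.

Lemma jb_bounded : exists M : R, 0 <= M /\
  forall a b c, rnorm (tp a b c) <= M * (rnorm a * rnorm b * rnorm c).
Proof.
have := @jbt_continuous _ _ _ Hjb (0, 0, 0) _ (nbhsx_ballx _ _ ltr01).
rewrite /= (tp0l Jt) => /nbhs_ballP[e /= e0 He].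
have [d d0 de] : exists2 d : R, 0 < d & d%:C < e.
  move: e0 {He}; case: e => u v; rewrite ltcE /= => /andP[/eqP -> u0].
  by exists (u / 2); rewrite ?divr_gt0 // ltcR ltr_pdivrMr // ltr_pMr // ltr1n.
exists (d ^- 3); split; first by rewrite invr_ge0 exprn_ge0 // ltW.
move=> a b c.
have [/rnorm_eq0->|a0] := eqVneq (rnorm a) 0.
  by rewrite (tp0l Jt) !(rnorm0, mul0r, mulr0).
have [/rnorm_eq0->|b0] := eqVneq (rnorm b) 0.
  by rewrite (tp0m Jt) !(rnorm0, mul0r, mulr0).
have [/rnorm_eq0->|c0] := eqVneq (rnorm c) 0.
  by rewrite (tp0r Jt) !(rnorm0, mul0r, mulr0).
have pos (x : E) : rnorm x != 0 -> 0 < rnorm x.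
  by move=> x0; rewrite lt_neqAle eq_sym x0 rnorm_ge0.
move/pos: a0 => a0; move/pos: b0 => b0; move/pos: c0 => c0.
pose s (x : E) : R[i] := (d / rnorm x)%:C.
have sE (x : E) : 0 < rnorm x -> rnorm (s x) = d / rnorm x.
  by move=> x0; rewrite rnormR ger0_norm // divr_ge0 ?ltW.
have sball (x : E) : 0 < rnorm x -> ball (0 : E) e (s x *: x).
  move=> x0; rewrite -ball_normE /= sub0r normrN rnormE rnormZ sE //.
  by rewrite divfK ?gt_eqF.
have Hb : ball (0 : E * E * E) e (s a *: a, s b *: b, s c *: c).
  by split; [split|]; apply: sball.
have := He _ Hb; rewrite -ball_normE /= sub0r normrN rnormE.
rewrite -(rmorph1 (real_complex R)) ltcR.
rewrite jb_scalel jb_scalem jb_scaler !rnormZ.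
have -> : Num.conj (s b) = s b by exact: conjc_real.
rewrite !sE // => /ltW HT.
rewrite -(@ler_pM2l _ ((d / rnorm a) * (d / rnorm b) * (d / rnorm c)));
  last by rewrite !mulr_gt0 ?invr_gt0.
rewrite -!mulrA in HT *; apply: le_trans HT _.
rewrite le_eqVlt; apply/orP; left; apply/eqP.
by field; rewrite !gt_eqF.
Qed.

Lemma jb_cube a : rnorm (tp a a a) = rnorm a ^+ 3.
Proof. by apply: complexI; rewrite rmorphXn /= -!rnormE jbt_norm. Qed.

Lemma jb_aniso y : tp y y y = 0 -> y = 0.
Proof.
move=> y3; apply: rnorm_eq0; apply/eqP.
by have /eqP := jb_cube y; rewrite y3 rnorm0 eq_sym expf_eq0.
Qed.

Lemma jb_box_bounded a b : bounded_linear (tp a b).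
Proof.
split=> [x y|k x|]; [exact: (tpDr Jt) | exact: jb_scaler|].
have [M [M0 HM]] := jb_bounded.
exists (M * (rnorm a * rnorm b)); split; first by rewrite !mulr_ge0 ?rnorm_ge0.
by move=> x; rewrite -mulrA.
Qed.

End JBstar.

(** * Polynomials in a self-adjoint element *)

Lemma poly_lin_ind (F : nzRingType) (P : {poly F} -> Prop) :
  P 0 -> (forall n, P 'X^n) ->
  (forall k p q, P p -> P q -> P (k *: p + q)) -> forall p, P p.
Proof.
move=> P0 PX PL p; rewrite -[p]coefK poly_def.
by elim/big_rec: _ => // i q _; apply: PL.
Qed.

Section PolynomialCalculus.
Variables (R : realType) (E : completeNormedModType R[i]).
Variable tp : E -> E -> E -> E.
Hypothesis Hjb : is_JBstar_triple tp.
Local Notation Jt := (JBstar_jordan_triple Hjb).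
Local Notation conjp := (map_poly (@Num.conj R[i])).

Section Evaluation.
Variables e b : E.

Definition jeval (p : {poly R[i]}) : E :=
  \sum_(i < size p) p`_i *: jpow tp e b i.

Lemma jeval_widen n (p : {poly R[i]}) : (size p <= n)%N ->
  jeval p = \sum_(i < n) p`_i *: jpow tp e b i.
Proof.
move=> pn; rewrite /jeval (big_ord_widen n (fun i => p`_i *: jpow tp e b i) pn).
rewrite big_mkcond /=; apply: eq_bigr => i _; case: ifP => // /negbT.
by rewrite -leqNgt => /leq_sizeP -> //; rewrite scale0r.
Qed.

Lemma jeval_lin k p q : jeval (k *: p + q) = k *: jeval p + jeval q.
Proof.
pose n := maxn (size (k *: p + q)) (maxn (size p) (size q)).
rewrite !(@jeval_widen n) ?leq_max ?leqnn ?orbT //.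
rewrite scaler_sumr -big_split /=; apply: eq_bigr => i _.
by rewrite coefD coefZ scalerDl scalerA.
Qed.

Lemma jeval0 : jeval 0 = 0.
Proof. by rewrite /jeval size_poly0 big_ord0. Qed.

Lemma jevalD p q : jeval (p + q) = jeval p + jeval q.
Proof. by have := jeval_lin 1 p q; rewrite !scale1r. Qed.

Lemma jevalZ k p : jeval (k *: p) = k *: jeval p.
Proof. by have := jeval_lin k p 0; rewrite jeval0 !addr0. Qed.

Lemma jeval_sum (I : Type) (r : seq I) (F : I -> {poly R[i]}) :
  jeval (\sum_(i <- r) F i) = \sum_(i <- r) jeval (F i).
Proof. by apply: (big_morph jeval jevalD jeval0). Qed.

Lemma jevalXn n : jeval 'X^n = jpow tp e b n.
Proof.
rewrite (@jeval_widen n.+1) ?size_polyXn // big_ord_recr /= coefXn eqxx scale1r.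
by rewrite big1 ?add0r // => i _; rewrite coefXn ltn_eqF ?scale0r.
Qed.

Hypotheses (He : tripotent tp e) (sb : sa tp e b).

(** The conjugate on q reflects antilinearity in the middle variable. *)
Lemma jeval_triple p q r :
  tp (jeval p) (jeval q) (jeval r) = jeval (p * conjp q * r).
Proof.
elim/poly_lin_ind: p => [|i|k p p' IH IH'].
- by rewrite !mul0r jeval0 (tp0l Jt).
- elim/poly_lin_ind: q => [|j|k q q' IH IH'].
  + by rewrite rmorph0 mulr0 mul0r jeval0 (tp0m Jt).
  + elim/poly_lin_ind: r => [|l|k r r' IH IH'].
    * by rewrite mulr0 jeval0 (tp0r Jt).
    * by rewrite map_polyXn -!exprD !jevalXn (jpow_triple Jt).
    * rewrite jeval_lin (tpDr Jt) (jb_scaler Hjb) IH IH'.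
      by rewrite mulrDr -scalerAr jeval_lin.
  + rewrite jeval_lin (tpDm Jt) (jb_scalem Hjb) IH IH' rmorphD /= map_polyZ.
    by rewrite mulrDr mulrDl -scalerAr -scalerAl jeval_lin.
- rewrite jeval_lin (tpDl Jt) (jb_scalel Hjb) IH IH'.
  by rewrite !mulrDl -!scalerAl jeval_lin.
Qed.

Lemma jeval_cstar : exists M, cstar_seminorm (fun p => rnorm (jeval p)) M.
Proof.
have [M [M0 HM]] := jb_bounded Hjb; exists M.
have N1 : rnorm (jeval 1) <= 1.
  rewrite -(expr0 'X) jevalXn /=; have := jb_cube Hjb e; rewrite He => e3.
  by rewrite leNgt; apply/negP => e1; have := rnorm_ge0 e; nra.
split=> // [p|p q|c p|p|].
- exact: rnorm_ge0.
- by rewrite jevalD rnormD.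
- by rewrite jevalZ rnormZ.
- by rewrite -jeval_triple jb_cube.
split=> // p q; have -> : p * q = p * conjp 1 * q by rewrite rmorph1 mulr1.
rewrite -jeval_triple; apply: le_trans (HM _ _ _) _; rewrite ler_wpM2l //.
by rewrite mulrAC ler_piMr // mulr_ge0 ?rnorm_ge0.
Qed.

(** The odd powers of a = b^2 are obtained from a by iterating L(a,a), hence do
    not depend on the tripotent e. *)
Lemma jpow_odd_square j :
  jpow tp e b (4 * j + 2) = iter j (tp (tp b e b) (tp b e b)) (tp b e b).
Proof.
elim: j => [|j IH]; first by rewrite (jpow2 Jt).
rewrite iterS -IH -!(jpow2 Jt sb) (jpow_triple Jt) //; congr (jpow _ _ _ _).
by lia.
Qed.

End Evaluation.

(** The polynomial F(z) = sum of the z^k v_k is the difference of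
    (1 - z a)^n a computed in E_2(e) and in E_2(f).  It is odd by
    [jpow_odd_square], bounded by a constant for |z| = n^(-1/2), Re z >= 0 by
    [csn_bound], hence on the whole circle, and v_1 is -n times the difference
    of the two squares of a; n = (m+1)^2 avoids square roots. *)
Lemma square_unique_small e f b c : tripotent tp e -> tripotent tp f ->
  sa tp e b -> sa tp f c -> tp b e b = tp c f c ->
  rnorm (tp b e b) <= 8^-1 ->
  tp (tp b e b) e (tp b e b) = tp (tp b e b) f (tp b e b).
Proof.
move=> He Hf sb sc bc small.
pose v (n k : nat) : E := ((-1) ^+ k *+ 'C(n, k)) *:
  (jpow tp e b (2 * k + 2) - jpow tp f c (2 * k + 2)).
have vE e' b' n z : \sum_(k < n.+1) z ^+ k *:
     (((-1) ^+ k *+ 'C(n, k)) *: jpow tp e' b' (2 * k + 2))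
    = jeval e' b' ((1 - z *: 'X^2) ^+ n * 'X^2).
  rewrite exprBn mulr_suml jeval_sum; apply: eq_bigr => k _.
  rewrite scalerA -jevalXn -jevalZ; congr jeval.
  rewrite expr1n mulr1 exprZn -exprM exprD -!mul_polyC polyCM polyCMn.
  rewrite [in RHS]mulrnAl [in LHS]mulrnAr [in LHS]mulrnAl; congr (_ *+ _).
  have -> : ((-1) ^+ k)%:P = (-1) ^+ k :> {poly R[i]}.
    by rewrite rmorphXn /= polyCN.
  by ring.
have vev n k : ~~ odd k -> v n k = 0.
  move=> /even_halfK ek; rewrite /v.
  have -> : (2 * k + 2 = 4 * k./2 + 2)%N by move: ek; lia.
  by rewrite !jpow_odd_square // -bc subrr scaler0.
have FE n z : \sum_(k < n.+1) z ^+ k *: v n k =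
    jeval e b ((1 - z *: 'X^2) ^+ n * 'X^2)
    - jeval f c ((1 - z *: 'X^2) ^+ n * 'X^2).
  rewrite -!vE -sumrB; apply: eq_bigr => k _.
  by rewrite /v scalerBr scalerBr.
have [M1 N1] := jeval_cstar He sb; have [M2 N2] := jeval_cstar Hf sc.
have Fhalf m z : rnorm z = m.+1%:R^-1 -> 0 <= complex.Re z ->
    rnorm (\sum_(k < (m.+1 ^ 2).+1) z ^+ k *: v (m.+1 ^ 2)%N k) <= expR 1.
  move=> rz Rz; rewrite FE.
  have X1 : rnorm (jeval e b 'X^2) <= 8^-1 by rewrite jevalXn (jpow2 Jt).
  have X2 : rnorm (jeval f c 'X^2) <= 8^-1 by rewrite jevalXn (jpow2 Jt) // -bc.
  have B1 := csn_bound N1 X1 Rz rz; have B2 := csn_bound N2 X2 Rz rz.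
  have C1 := csnM N1 ((1 - z *: 'X^2) ^+ (m.+1 ^ 2)) 'X^2.
  have C2 := csnM N2 ((1 - z *: 'X^2) ^+ (m.+1 ^ 2)) 'X^2.
  apply: le_trans (rnormD _ _) _; rewrite rnormN.
  apply: le_trans (lerD C1 C2) _.
  have e1 := @expR_ge0 R 1.
  have D1 := ler_pM (rnorm_ge0 _) (rnorm_ge0 _) B1 X1.
  have D2 := ler_pM (rnorm_ge0 _) (rnorm_ge0 _) B2 X2.
  by apply: le_trans (lerD D1 D2) _; lra.
have Fall m z : rnorm z = m.+1%:R^-1 ->
    rnorm (\sum_(k < (m.+1 ^ 2).+1) z ^+ k *: v (m.+1 ^ 2)%N k) <= expR 1.
  move=> rz; have [Rz|Rz] := leP 0 (complex.Re z); first exact: Fhalf.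
  have := Fhalf m (- z); rewrite rnormN => /(_ rz).
  have -> : complex.Re (- z) = - complex.Re z by case: (z).
  rewrite oppr_ge0 => /(_ (ltW Rz)); apply: le_trans; rewrite -rnormN -sumrN.
  rewrite le_eqVlt; apply/orP; left; apply/eqP; congr rnorm.
  apply: eq_bigr => k _; case: (boolP (odd k)) => ok; last first.
    by rewrite vev // !scaler0 oppr0.
  by rewrite exprNn -signr_odd ok expr1 mulN1r scaleNr.
set a := tp b e b in bc small *.
have Ja : tp a e a = jpow tp e b 4 by rewrite /a -(jpow2 Jt sb) (jpowD Jt).
have Jc : tp a f a = jpow tp f c 4 by rewrite bc -(jpow2 Jt sc) (jpowD Jt).
apply/eqP; rewrite -subr_eq0; apply/eqP/rnorm_eq0; rewrite Ja Jc.
set d := _ - _.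
have bd (m : nat) : m.+1%:R * rnorm d <= expR 1.
  have m0 : 0 < (m.+1%:R^-1 : R) by rewrite invr_gt0.
  have n0 : (0 < m.+1 ^ 2)%N by rewrite expn_gt0.
  have := cauchy_estimate m0 n0 (Fall m); rewrite /v rnormZ expr1 bin1.
  rewrite mulNrn rnormN -(rmorph_nat (real_complex R)) rnormR.
  by rewrite ger0_norm ?ler0n // natrX mulrA expr2 mulKf // pnatr_eq0.
apply/eqP; rewrite eq_le rnorm_ge0 andbT leNgt; apply/negP => d0.
have := bd (Num.trunc (expR 1 / rnorm d)); apply/negP; rewrite -ltNge.
by rewrite -ltr_pdivrMr //; apply: truncnS_gt.
Qed.

(** The square of a positive element does not depend on the tripotent: rescale
    to a small element. *)
Lemma square_unique e f b c : tripotent tp e -> tripotent tp f ->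
  sa tp e b -> sa tp f c -> tp b e b = tp c f c ->
  tp (tp b e b) e (tp b e b) = tp (tp b e b) f (tp b e b).
Proof.
move=> He Hf sb sc bc.
pose s : R := (8 * (rnorm (tp b e b) + 1))^-1.
have n0 := rnorm_ge0 (tp b e b).
have s0 : 0 < s by rewrite invr_gt0 mulr_gt0 // ltr_wpDl.
pose r : R := Num.sqrt s.
have r2 : r * r = s by rewrite -expr2 sqr_sqrtr // ltW.
have rJ : Num.conj (r%:C) = r%:C by exact: conjc_real.
have scale e' b' : tp (r%:C *: b') e' (r%:C *: b') = s%:C *: tp b' e' b'.
  by rewrite (jb_scalel Hjb) (jb_scaler Hjb) scalerA -rmorphM /= r2.
have sa_scale e' b' : sa tp e' b' -> sa tp e' (r%:C *: b').
  move=> [h1 h2].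
  by split; rewrite ?(jb_scaler Hjb) ?(jb_scalem Hjb) ?h1 ?h2 // rJ.
have := square_unique_small He Hf (sa_scale _ _ sb) (sa_scale _ _ sc).
rewrite !scale bc => /(_ erefl).
rewrite !(jb_scalel Hjb) !(jb_scaler Hjb) !scalerA -bc.
have ss : s%:C * s%:C != 0 :> R[i].
  rewrite -rmorphM /= -(rmorph0 (real_complex R)) (inj_eq (@complexI _)).
  by rewrite gt_eqF ?mulr_gt0.
move=> H; apply: (scalerI ss); apply: H.
rewrite rnormZ rnormR ger0_norm ?(ltW s0) // /s invfM -mulrA ger_pMr //.
by rewrite mulrC ler_pdivrMr ?ltr_wpDl // mul1r lerDl.
Qed.

End PolynomialCalculus.

(** * The Rickart property *)

Section Rickart.
Variables (R : realType) (E : completeNormedModType R[i]).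
Variable tp : E -> E -> E -> E.
Hypothesis Hjb : is_JBstar_triple tp.
Local Notation Jt := (JBstar_jordan_triple Hjb).

Lemma selfadjoint_partE e x :
  selfadjoint_part (peirce tp 2 e) (peirce2_star tp e) x <-> sa tp e x.
Proof.
have h : 2%:R / 2 = 1 :> R[i] by rewrite divff // pnatr_eq0.
by rewrite /selfadjoint_part /peirce /= /Lop /peirce2_star h scale1r.
Qed.

Lemma peirce0E e x : peirce tp 0 e x <-> tp e e x = 0.
Proof. by rewrite /peirce /= /Lop mul0r scale0r. Qed.

(** L(b o b, e) = L(b,b). *)
Lemma box_square_hermitian e b : sa tp e b -> hermitian_op (tp (tp b e b) e).
Proof.
move=> sb; have -> : tp (tp b e b) e = Lop tp b b.
  by apply/funext => w; rewrite /Lop (sa_box2 Jt w sb).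
exact: jbt_hermitian.
Qed.

(** [hermitian_nilp] is used three times: with B = 0 and H = A = L(a,e), to get
    A (e - f) = 0 from A^2 (e - f) = 0; and twice with B = L(a,f), to bring
    H^3 = 0 down to H = 0 for H = L(a,e-f). *)
Lemma positive_diff_annihilator e f b c : tripotent tp e -> tripotent tp f ->
  sa tp e b -> sa tp f c -> tp b e b = tp c f c ->
  annihilator tp (tp b e b) (e - f).
Proof.
move=> He Hf sb sc bc.
have eq_sq := square_unique Hjb He Hf sb sc bc.
have hA := box_square_hermitian sb; have hB := box_square_hermitian sc.
have sea := sa_mul Jt He sb sb; have sfa := sa_mul Jt Hf sc sc.
rewrite -bc in hB sfa; set a := tp b e b in eq_sq hA hB sea sfa *.
have h0 : hermitian_op (tp 0 0) by exact: (jbt_hermitian Hjb 0).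
have tpD x y u v : tp x y (u + v) = tp x y u + tp x y v := tpDr Jt x y u v.
have Az : tp a e (e - f) = 0.
  apply: (@hermitian_nilp _ _ (tp a e) (tp 0 0)) => //.
  - by move=> x; rewrite (tp0l Jt) add0r.
  - by move=> x; rewrite !(tp0l Jt) (tp0r Jt).
  - exact: jb_box_bounded.
  exact: (tripotents_sq0 Jt He Hf).
apply: (sub_tripotents_annihilator Jt He Hf) => // w.
have AE x : tp a e x = tp a f x + tp a (e - f) x.
  by rewrite (tpBm Jt) addrC subrK.
apply: (@hermitian_nilp _ _ (tp a e) (tp a f)) => //.
- move=> x; have := tripotents_box_comm Jt He Hf sea sfa eq_sq x Az.
  by rewrite !AE tpD => /addIr.
- exact: jb_box_bounded.
apply: (@hermitian_nilp _ _ (tp a e) (tp a f)) => //.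
- move=> x; have := tripotents_box_comm Jt He Hf sea sfa eq_sq x Az.
  by rewrite !AE tpD => /addIr.
- exact: jb_box_bounded.
exact: (tripotents_box_nilp Jt eq_sq).
Qed.

Lemma annihilator_inner_ideal a : inner_ideal tp (annihilator tp a).
Proof.
split=> [w|k x y ax ay w|x z y ax ay].
- by rewrite (tp0m Jt) (tp0l Jt).
- rewrite (tpDm Jt) (tpDl Jt) (jb_scalem Hjb) (jb_scalel Hjb).
  rewrite !(proj1 (ax _), proj2 (ax _), proj1 (ay _), proj2 (ay _)).
  by rewrite !scaler0 addr0.
- exact: (annihilator_tp Jt).
Qed.

Lemma annihilator_orthogonal a :
  orthogonal_sets tp (principal_inner_ideal tp a) (annihilator tp a).
Proof.
move=> u y clu ay z; rewrite /Lop.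
have ctp : continuous (fun v : E => tp v y z).
  move=> v.
  have c1 : (fun v : E => (v, y)) @ v --> (v, y).
    by apply: (cvg_pair cvg_id (cvg_cst y)).
  have c2 : (fun v : E => (v, y, z)) @ v --> (v, y, z).
    by apply: (cvg_pair c1 (cvg_cst z)).
  exact: (continuous_comp c2 (jbt_continuous Hjb (x := (v, y, z)))).
have cl0 : closed [set v : E | tp v y z = 0].
  have -> : [set v : E | tp v y z = 0] =
    (fun v : E => tp v y z) @^-1` [set 0] by [].
  apply: preimage_closed => [v _|]; [exact: ctp|].
  exact: accessible_closed_set1 (hausdorff_accessible (@norm_hausdorff _ E)) _.
have sub : range (Qop tp a) `<=` [set v : E | tp v y z = 0].
  by move=> _ [w _ <-]; apply: (annihilator_Q Jt).
have := closure_subset sub clu; rewrite -(closure_id _).1 //.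
Qed.

Lemma real_jordan_algebra_sa e : tripotent tp e ->
  real_jordan_algebra
    (selfadjoint_part (peirce tp 2 e) (peirce2_star tp e)) (peirce2_mul tp e).
Proof.
move=> He; split; rewrite /peirce2_mul.
- by apply/selfadjoint_partE; split; rewrite ?(tp0r Jt) ?(tp0m Jt).
- move=> r x y /selfadjoint_partE sx /selfadjoint_partE sy.
  apply/selfadjoint_partE; apply: (sa_D Jt) => //; case: sx => h1 h2.
  split; rewrite ?(jb_scaler Hjb) ?(jb_scalem Hjb) ?h1 ?h2 //.
  by congr (_ *: _); apply: conjc_real.
- move=> x y /selfadjoint_partE sx /selfadjoint_partE sy.
  by apply/selfadjoint_partE; apply: (sa_mul Jt).
- by move=> x y _ _; rewrite (tpC Jt).
- by move=> r x y z _ _ _; rewrite (tpDl Jt) (jb_scalel Hjb).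
- move=> x y /selfadjoint_partE sx /selfadjoint_partE sy.
  by rewrite [tp y e _](tpC Jt) (sa_jordan Jt) // [LHS](tpC Jt).
Qed.

End Rickart.

Theorem proposition4p4 (R : realType) (E : completeNormedModType R[i])
    (tp : E -> E -> E -> E)
    (E_JBstar_triple : is_JBstar_triple tp)
    (E_weakly_order_rickart : weakly_order_rickart tp)
    (e : E) (e_tripotent : tripotent tp e) :
  rickart_JBstar_algebra (peirce tp 2 e) (peirce2_mul tp e)
    (peirce2_star tp e).
Proof.
have Jt := JBstar_jordan_triple E_JBstar_triple.
split; first exact: real_jordan_algebra_sa.
move=> _ [b /selfadjoint_partE sb <-]; rewrite /peirce2_mul.
set a := tp b e b; have sa_a : sa tp e a by apply: (sa_mul Jt).
have [f [Hf [c /selfadjoint_partE sc ca] Jf]] :=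
  E_weakly_order_rickart a _ (annihilator_inner_ideal E_JBstar_triple a)
    (@annihilator_orthogonal _ _ _ E_JBstar_triple a).
have [p ep Jp] : exists2 p, e = f + p & annihilator tp a p.
  exists (e - f); first by rewrite addrC subrK.
  exact: (positive_diff_annihilator E_JBstar_triple e_tripotent Hf sb sc
    (esym ca)).
have perp y w : annihilator tp a y -> tp f y w = 0 /\ tp y f w = 0.
  by move=> /Jf/peirce0E fy; apply: (peirce02 Jt).
have ppp : tp p p p = p.
  apply: (addrI f); rewrite -ep -[in RHS]e_tripotent ep.
  rewrite !(tpDl Jt, tpDm Jt, tpDr Jt).
  have ffp : tp f f p = 0 by rewrite (tpC Jt) (proj2 (perp _ _ Jp)).
  have ppf : tp p p f = 0 by rewrite (tpC Jt) (proj1 (perp _ _ Jp)).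
  rewrite !(proj1 (perp p _ Jp), proj2 (perp p _ Jp)) ffp ppf Hf.
  by rewrite !(addr0, add0r).
have epw y w : annihilator tp a y -> tp e y w = tp p y w /\ tp y e w = tp y p w.
  move=> ay; rewrite {1 2}ep (tpDl Jt) (tpDm Jt).
  by rewrite (proj1 (perp y w ay)) (proj2 (perp y w ay)) !add0r.
have ppe : tp p p e = p by rewrite (tpC Jt) (proj1 (epw _ _ Jp)).
have sp : sa tp e p.
  by split; rewrite ?(proj1 (epw _ _ Jp)) // (tpC Jt) (proj2 (epw _ _ Jp)).
have UE z w : sa tp e w -> Uop (peirce2_mul tp e) z w = tp z w z.
  case=> _ sw; rewrite -{2}sw (sa_U Jt) /Uop /peirce2_mul.
  by rewrite [tp (tp z e w) e z](tpC Jt).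
exists p; split.
- exact/selfadjoint_partE.
- by rewrite (proj2 (epw _ _ Jp)).
apply/seteqP; split=> z /=.
  move=> [/selfadjoint_partE sz]; rewrite UE // => zaz.
  have Jz : annihilator tp a z.
    move=> w; have [h1 h2] :=
      sa_orth Jt e_tripotent (jb_aniso E_JBstar_triple) w sb sz zaz.
    by split.
  exists z; first exact/selfadjoint_partE.
  rewrite UE // -[RHS](proj2 sz) (proj1 (epw _ _ Jz)).
  by rewrite [RHS](tpC Jt) (proj1 (epw _ _ Jz)).
move=> [n /selfadjoint_partE sn <-]; rewrite UE //.
have Jz : annihilator tp a (tp p n p) by apply: (annihilator_tp Jt).
split; first by apply/selfadjoint_partE; apply: (sa_Q Jt).
by rewrite UE // (proj2 (Jz _)).
Qed.
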